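(* There is a universal constant $c_0>0$ such that for all universal constants $0<c_2\le c_1\le c_0$ there exists a universal constant $c_3>0$ such that the following holds. Let $\delta\in(0,1)$, $\varepsilon\in(0,1]$ and $\gamma\in[1/2,1)$. Suppose the learning rates satisfy, for all $0\le t\le T$, $$\frac{1}{1+\frac{c_1(1-\gamma)T}{\log^3 T}}\le\eta_t\le\frac{1}{1+\frac{c_2(1-\gamma)t}{\log^3 T}},$$ and $$T\ge\frac{c_3(\log^4T)\,\log\frac{|\mathcal S||\mathcal A|T}{\delta}}{(1-\gamma)^4\varepsilon^2}.$$ If $0\le Q_0(s,a)\le\frac{1}{1-\gamma}$ for all $(s,a)\in\mathcal S\times\mathcal A$, then with probability at least $1-\delta$, synchronous Q-learning satisfies $\max_{(s,a)}|Q_T(s,a)-Q^\star(s,a)|\le\varepsilon$.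
   Context: A discounted MDP $(\mathcal S,\mathcal A,P,r,\gamma)$ has finite state space $\mathcal S$, finite action space $\mathcal A$, transition kernel $P(\cdot\mid s,a)\in\Delta(\mathcal S)$, reward $r:\mathcal S\times\mathcal A\to[0,1]$ and discount $\gamma\in(0,1)$. For a policy $\pi$, $Q^\pi(s,a)=\mathbb E[\sum_{k\ge0}\gamma^k r(s_k,a_k)\mid s_0=s,a_0=a]$ with $a_k\sim\pi(\cdot\mid s_k)$ for $k\ge1$, $s_{k+1}\sim P(\cdot\mid s_k,a_k)$; $Q^\star(s,a)=\max_\pi Q^\pi(s,a)$, $V^\star(s)=\max_a Q^\star(s,a)$. Synchronous Q-learning (generative model): in each iteration $t=1,\dots,T$, for each $(s,a)$ an independent sample $s_t(s,a)\sim P(\cdot\mid s,a)$ is drawn (independent across pairs and iterations), and $Q_t(s,a)=(1-\eta_t)Q_{t-1}(s,a)+\eta_t\big(r(s,a)+\gamma\max_{a'}Q_{t-1}(s_t(s,a),a')\big)$ for all $(s,a)$, with learning rates $\eta_t\in(0,1]$; also $V_t(s)=\max_a Q_t(s,a)$. Logarithms are natural. *)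

(* Defs.v *)
From HB Require Import structures.
From mathcomp Require Import all_boot all_order all_algebra.
From mathcomp Require Import all_classical all_reals all_analysis.
Set Implicit Arguments. Unset Strict Implicit. Unset Printing Implicit Defensive.
Import Order.TTheory GRing.Theory Num.Theory numFieldNormedType.Exports.
Local Open Scope ring_scope.

Section MDP.
Variables (R : realType) (S A : finType).

Definition is_kernel (P : S -> A -> S -> R) : Prop :=
  (forall s a s', 0 <= P s a s') /\ (forall s a, \sum_(s' : S) P s a s' = 1).

Definition is_policy (pi : S -> A -> R) : Prop :=
  (forall s a, 0 <= pi s a) /\ (forall s, \sum_(a : A) pi s a = 1).

(* occ P pi k x y = Pr[(s_k, a_k) = y | (s_0, a_0) = x] under policy pi *)
Fixpoint occ (P : S -> A -> S -> R) (pi : S -> A -> R) (k : nat)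
    (x y : S * A) : R :=
  match k with
  | 0 => (x == y)%:R
  | k'.+1 => \sum_(z : S * A) occ P pi k' x z * (P z.1 z.2 y.1 * pi y.1 y.2)
  end.

Definition Qpi (P : S -> A -> S -> R) (r : S -> A -> R) (gamma : R)
    (pi : S -> A -> R) (s : S) (a : A) : R :=
  limn (@series R (fun k : nat =>
    gamma ^+ k * \sum_(y : S * A) occ P pi k (s, a) y * r y.1 y.2)).

(* Q^*(s,a) = max_pi Q^pi(s,a) (written as the supremum over stationary
   randomized policies) *)
Definition Qstar (P : S -> A -> S -> R) (r : S -> A -> R) (gamma : R)
    (s : S) (a : A) : R :=
  sup [set q | exists pi, is_policy pi /\ q = Qpi P r gamma pi s a].

(* maximum over actions; a0 : A witnesses that A is nonempty *)
Definition vmax (a0 : A) (Q : S -> A -> R) (s : S) : R :=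
  \big[Num.max/Q s a0]_(a : A) Q s a.

Fixpoint Qlearn (a0 : A) (r : S -> A -> R) (gamma : R) (eta : nat -> R)
    (Q0 : S -> A -> R) (samp : nat -> S -> A -> S) (t : nat) : S -> A -> R :=
  match t with
  | 0 => Q0
  | t'.+1 => fun s a =>
      (1 - eta t) * Qlearn a0 r gamma eta Q0 samp t' s a
      + eta t * (r s a + gamma * vmax a0 (Qlearn a0 r gamma eta Q0 samp t') (samp t s a))
  end.

(* a full sample outcome for iterations 1..T: omega (i, s, a) = s_{i+1}(s,a) *)
Definition sample_of (T : nat) (omega : {ffun 'I_T * S * A -> S})
    (t : nat) (s : S) (a : A) : S :=
  match @insub _ (fun i => i < T)%N 'I_T t.-1 with
  | Some i => if (0 < t)%N then omega (i, s, a) else s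
  | None => s
  end.

Definition Prob (P : S -> A -> S -> R) (T : nat)
    (E : pred {ffun 'I_T * S * A -> S}) : R :=
  \sum_(omega | E omega) \prod_(k : 'I_T * S * A) P k.1.2 k.2 (omega k).

End MDP.

(* Main.v *)
(** Write [H = 1 / (1 - gamma)].  Only the second half of the run matters: there
    the step sizes lie between two multiples of [ln T ^ 3 / ((1 - gamma) T)], so
    the initial error, at most [H], is forgotten.

    Let [N] be the exponentially weighted average of the sampling innovations.
    Freedman's exponential supermartingale and a union bound give, for all
    pairs and times at once, [|N| <= lam K + l / lam], where [K] is the
    accumulated conditional variance and [lam] is a fixed parameter of order
    [eps (1 - gamma)^2 / eta].  This is linear in the variance, hence stable
    under bootstrapping: [Var V <= 2 Var V* + 2 m^2] when [|V - V*| <= m].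

    On this event [|Q - Q*| <= m - 2 alpha (Q* )^2] is propagated by induction
    for a scalar [m] which decays geometrically to [eps / 2].  The quadratic term
    is the Lyapunov function behind the law of total variance: the Bellman
    equation gives [(Q* )^2 - gamma P (V* )^2 <= 2 H - gamma Var V*], so its drift
    pays for the noise, of size [alpha Var V*], and the sum of the variances
    along a trajectory costs [H^2] rather than [H^3].  Since [q - 2 alpha q^2] is
    increasing on [[0, H]], the envelope survives the maximum over actions, and
    the random greedy policies never have to be followed. *)

Require Import Defs.
From HB Require Import structures.
From mathcomp Require Import all_boot all_order all_algebra.
From mathcomp Require Import all_classical all_reals all_analysis.
From mathcomp Require Import ring lra.
Import Order.TTheory GRing.Theory Num.Theory numFieldNormedType.Exports.
Local Open Scope classical_set_scope.
Local Open Scope ring_scope.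

Set Implicit Arguments.
Unset Strict Implicit.
Unset Printing Implicit Defensive.

(** * Conditional mean and variance *)

Lemma expR_le_quadratic (R : realType) (y : R) :
  `|y| <= 4^-1 -> expR y <= 1 + y + y ^+ 2.
Proof.
rewrite ler_norml => /andP[y_lo y_hi].
(* [expR y = expR (- y / 2) ^- 2] and [expR (- y / 2) >= 1 - y / 2 > 0]. *)
have e1 := expR_ge1Dx (- (y / 2)).
have e2 : expR y * expR (- (y / 2)) ^+ 2 = 1.
  by rewrite -expRM_natl -expRD -mulr_natl mulrN mulrC divfK ?subrr ?expR0.
have : expR y * (1 - y / 2) ^+ 2 <= 1.
  rewrite -[leRHS]e2; apply: ler_wpM2l; first exact: expR_ge0.
  apply: lerXn2r; rewrite ?nnegrE ?expR_ge0 //; lra.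
(* The correction [1 - 3 * y + y ^+ 2] stays positive because [y <= 1/4]. *)
have : 1 <= (1 + y + y ^+ 2) * (1 - y / 2) ^+ 2.
  have -> : (1 + y + y ^+ 2) * (1 - y / 2) ^+ 2
    = 1 + y ^+ 2 / 4 * (1 - 3 * y + y ^+ 2) by field.
  rewrite lerDl mulr_ge0 ?divr_ge0 ?sqr_ge0 //; nra.
have : 0 < (1 - y / 2) ^+ 2 by rewrite exprn_gt0 //; lra.
move=> c_gt0 l1 l2; rewrite -(ler_pM2r c_gt0); exact: le_trans l2 l1.
Qed.

Section OneStep.
Variables (R : realType) (S : finType) (p : S -> R).
Hypotheses (p_ge0 : forall s, 0 <= p s) (p_sum1 : \sum_s p s = 1).
Implicit Types (f g : S -> R).

Definition mean f : R := \sum_s p s * f s.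

Definition mvariance f : R := mean (fun s => (f s - mean f) ^+ 2).

Lemma meanD f g : mean (fun s => f s + g s) = mean f + mean g.
Proof. by rewrite -big_split; apply: eq_bigr => s _ /=; rewrite mulrDr. Qed.

Lemma meanZ (c : R) f : mean (fun s => c * f s) = c * mean f.
Proof. by rewrite /mean mulr_sumr; apply: eq_bigr => s _; rewrite mulrCA. Qed.

Lemma meanC (c : R) : mean (fun=> c) = c.
Proof. by rewrite /mean -mulr_suml p_sum1 mul1r. Qed.

Lemma meanB f g : mean (fun s => f s - g s) = mean f - mean g.
Proof.
rewrite meanD -[X in _ = _ + X]mulN1r -meanZ; congr (_ + _).
by apply: eq_bigr => s _; rewrite mulN1r.
Qed.

Lemma le_mean f g : (forall s, f s <= g s) -> mean f <= mean g.
Proof. by move=> fg; apply: ler_sum => s _; rewrite ler_wpM2l. Qed.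

Lemma mean_bounds (lo hi : R) f :
  (forall s, lo <= f s <= hi) -> lo <= mean f <= hi.
Proof.
move=> fb; apply/andP; split; [rewrite -(meanC lo)|rewrite -(meanC hi)];
  by apply: le_mean => s; case/andP: (fb s).
Qed.

Lemma mvariance_ge0 f : 0 <= mvariance f.
Proof. by apply: sumr_ge0 => s _; rewrite mulr_ge0 ?sqr_ge0. Qed.

Lemma mean_sqrB f (c : R) :
  mean (fun s => (f s - c) ^+ 2) = mvariance f + (mean f - c) ^+ 2.
Proof.
pose h s := (f s - mean f) ^+ 2.
have -> : mean (fun s => (f s - c) ^+ 2)
    = mean (fun s => h s + (2 * (mean f - c) * (f s - mean f)
                            + (mean f - c) ^+ 2)).
  by apply: eq_bigr => s _; rewrite /h; congr (_ * _); ring.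
rewrite !meanD meanZ meanB !meanC subrr mulr0 add0r //.
Qed.

Lemma mean_sqr f : mean (fun s => f s ^+ 2) = mvariance f + mean f ^+ 2.
Proof.
rewrite -[X in _ + X ^+ 2]subr0 -mean_sqrB.
by apply: eq_bigr => s _; rewrite subr0.
Qed.

(** The mean is the best centre, so [f] may be centred at [mean g] instead; then
    [(a + b)^2 <= 2 a^2 + 2 b^2]. *)
Lemma mvariance_perturb f g (m : R) :
  (forall s, `|f s - g s| <= m) -> mvariance f <= 2 * mvariance g + 2 * m ^+ 2.
Proof.
move=> fg; apply: (@le_trans _ _ (mean (fun s => (f s - mean g) ^+ 2))).
  by rewrite mean_sqrB lerDl sqr_ge0.
rewrite -(meanC (2 * m ^+ 2)) -meanZ -meanD; apply: le_mean => s.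
have : (f s - g s) ^+ 2 <= m ^+ 2.
  by have := fg s; rewrite ler_norml => /andP[? ?]; nra.
have := sqr_ge0 ((f s - g s) - (g s - mean g)); nra.
Qed.

Lemma mvariance_le_sqr f (H : R) :
  (forall s, 0 <= f s <= H) -> mvariance f <= H ^+ 2.
Proof.
move=> fb; have : mean (fun s => f s ^+ 2) <= mean (fun=> H ^+ 2).
  by apply: le_mean => s; case/andP: (fb s) => f0 fH; nra.
by rewrite meanC mean_sqr; move=> h; apply: le_trans h; rewrite lerDl sqr_ge0.
Qed.

(** The linear term of the quadratic bound averages to zero, and [1 + u <= expR u] restores an
    exponential, which can be multiplied along a martingale. *)
Lemma mean_expR_le (x : R) f :
  (forall s, `|x * (f s - mean f)| <= 4^-1) ->
  mean (fun s => expR (x * (f s - mean f))) <= expR (x ^+ 2 * mvariance f).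
Proof.
move=> xb; apply: le_trans (expR_ge1Dx _).
have -> : 1 + x ^+ 2 * mvariance f
    = mean (fun s => (1 + x * (f s - mean f)) + x ^+ 2 * (f s - mean f) ^+ 2).
  by rewrite !meanD !meanZ meanB !meanC // subrr mulr0 addr0.
apply: le_mean => s; apply: le_trans (expR_le_quadratic (xb s)) _.
by rewrite exprMn.
Qed.

End OneStep.

Section VMax.
Variables (R : realType) (S A : finType) (a0 : A).
Implicit Types Q : S -> A -> R.

Lemma le_vmax Q s a : Q s a <= vmax a0 Q s.
Proof. by rewrite /vmax; apply: le_bigmax. Qed.

Lemma vmax_attained Q s : exists a, vmax a0 Q s = Q s a.
Proof.
rewrite /vmax; apply: (big_ind (fun x => exists a, x = Q s a)) => [|x y [a ->] [b ->]|a _]; first by exists a0.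
  by case: leP => _; [exists b | exists a].
by exists a.
Qed.

Lemma vmax_le Q s (c : R) : (forall a, Q s a <= c) -> vmax a0 Q s <= c.
Proof. by move=> Qc; have [a ->] := vmax_attained Q s. Qed.

End VMax.

(** * Optimal action values *)

Section Bellman.
Variables (R : realType) (S A : finType) (a0 : A).
Variables (P : S -> A -> S -> R) (r : S -> A -> R) (gamma : R).
Hypotheses (P_kernel : is_kernel P) (r_bounds : forall s a, 0 <= r s a <= 1).
Hypotheses (gamma_ge0 : 0 <= gamma) (gamma_lt1 : gamma < 1).
Implicit Types Q : S -> A -> R.

Local Notation H := (1 - gamma)^-1.

Let P_ge0 s a s' : 0 <= P s a s'. Proof. by case: P_kernel. Qed.
Let P_sum1 s a : \sum_s' P s a s' = 1. Proof. by case: P_kernel. Qed.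

Definition bellman Q (s : S) (a : A) : R :=
  r s a + gamma * mean (P s a) (vmax a0 Q).

Lemma horizon_gt0 : 0 < H.
Proof. by rewrite invr_gt0 subr_gt0. Qed.

Lemma horizon_eq : 1 + gamma * H = H.
Proof.
have : 1 - gamma != 0 by rewrite subr_eq0 eq_sym lt_eqF.
by move=> ?; field.
Qed.

(** One-sided form that serves twice: [c = 0] gives monotonicity, positive [c] gives contraction. *)
Lemma bellman_shift Q Q' (c : R) :
  (forall s a, Q' s a <= Q s a + c) ->
  forall s a, bellman Q' s a <= bellman Q s a + gamma * c.
Proof.
move=> QQ' s a; rewrite /bellman -addrA lerD2l -mulrDr ler_wpM2l //.
rewrite -[X in _ <= _ + X](meanC (P_sum1 s a) c) -meanD; apply: le_mean => // s'.
by apply: vmax_le => b; rewrite (le_trans (QQ' _ _)) // lerD2r le_vmax.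
Qed.

Lemma bellman_bounds Q :
  (forall s a, 0 <= Q s a <= H) -> forall s a, 0 <= bellman Q s a <= H.
Proof.
move=> Qb s a; have /andP[r0 r1] := r_bounds s a.
have /andP[m0 m1] : 0 <= mean (P s a) (vmax a0 Q) <= H.
  apply: mean_bounds => // s'; have [b ->] := vmax_attained a0 Q s'; exact: Qb.
rewrite /bellman addr_ge0 ?mulr_ge0 //= -[leRHS]horizon_eq lerD //.
exact: ler_wpM2l.
Qed.

(** Value iteration from zero increases and is bounded by [H], hence converges. By [W_close] the
    remaining gap is at most [gamma ^+ n * H], so the fixed-point equation follows from two
    inequalities up to a vanishing error. *)
Lemma bellman_fixpoint : exists Q,
  (forall s a, Q s a = bellman Q s a) /\ (forall s a, 0 <= Q s a <= H).
Proof.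
pose W n := iter n bellman (fun=> fun=> 0).
have W_bounds n s a : 0 <= W n s a <= H.
  elim: n s a => [|n IH] s a; first by rewrite lexx ltW ?horizon_gt0.
  exact: bellman_bounds.
have W_close n k s a : W (k + n)%N s a <= W n s a + gamma ^+ n * H.
  elim: n k s a => [|n IH] k s a.
    by rewrite addn0 expr0 mul1r add0r; case/andP: (W_bounds k s a).
  by rewrite addnS exprS -mulrA; apply: bellman_shift.
have W_step n s a : W n s a <= W n.+1 s a.
  elim: n s a => [|n IH] s a; first by case/andP: (W_bounds 1%N s a).
  rewrite -[leRHS]addr0 -(mulr0 gamma).
  by apply: bellman_shift => {}s {}a; rewrite addr0.
have W_nd s a : nondecreasing_seq (fun n => W n s a).
  by apply/nondecreasing_seqP => n; exact: W_step.
have W_cvg s a : cvgn (fun n => W n s a).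
  apply: nondecreasing_is_cvgn => //; exists H => _ [n _ <-].
  by case/andP: (W_bounds n s a).
pose Q s a := limn (fun n => W n s a).
have W_leQ n s a : W n s a <= Q s a by exact: nondecreasing_cvgn_le.
have Q_leW n s a : Q s a <= W n s a + gamma ^+ n * H.
  apply: limr_le => //; exists n => //= m /= nm.
  by rewrite -(subnK nm); exact: W_close.
have gammaH_cvg : (fun n => gamma ^+ n * H)%R @ \oo --> (0 : R).
  rewrite -(mul0r H); apply: cvgMl; apply: cvg_expr.
  by rewrite ger0_norm.
have le_of_cvg x y :
    (forall n, x <= y + gamma ^+ n * H) -> x <= y.
  move=> xy; rewrite -subr_le0.
  rewrite -(cvg_lim _ gammaH_cvg) //; apply: limr_ge; first by apply/cvg_ex; exists 0.
  by near=> n; rewrite lerBlDl.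
exists Q; split=> s a; last first.
  by rewrite (le_trans _ (W_leQ 0%N s a)) //= limr_le //;
    apply: nearW => n; case/andP: (W_bounds n s a).
apply/le_anti/andP; split; apply: le_of_cvg => n.
  rewrite (le_trans (Q_leW n.+1 s a)) // lerD //.
    rewrite -[leRHS]addr0 -(mulr0 gamma).
    by apply: bellman_shift => {}s {}a; rewrite addr0.
  rewrite ler_wpM2r ?(ltW horizon_gt0) // exprS ler_piMl ?exprn_ge0 //.
  exact: ltW.
rewrite (le_trans (bellman_shift (Q_leW n) s a)) // lerD ?(W_leQ n.+1) //.
rewrite ler_piMl ?(ltW gamma_lt1) // mulr_ge0 ?exprn_ge0 //.
exact: ltW horizon_gt0.
Unshelve. all: by end_near.
Qed.

(** * Truncated returns of a fixed policy *)

Section Policy.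
Variables (pi : S -> A -> R).
Hypothesis pi_policy : is_policy pi.

Let pi_ge0 s a : 0 <= pi s a. Proof. by case: pi_policy. Qed.

Definition policy_step (f : S * A -> R) (x : S * A) : R :=
  mean (P x.1 x.2) (fun s => mean (pi s) (fun a => f (s, a))).

Lemma policy_stepE (f : S * A -> R) x :
  policy_step f x = \sum_z P x.1 x.2 z.1 * pi z.1 z.2 * f z.
Proof.
rewrite /policy_step /mean.
under eq_bigr do rewrite mulr_sumr.
by rewrite pair_bigA; apply: eq_bigr => -[s a] _ /=; rewrite mulrA.
Qed.

(** [occ] peels off the last transition, whereas the recursion for returns conditions on the first
    one. *)
Lemma occ_first_step k x y :
  occ P pi k.+1 x y = policy_step (fun z => occ P pi k z y) x.
Proof.
rewrite policy_stepE; elim: k x y => [|k IH] x y.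
  rewrite /= (bigD1 x) //= eqxx mul1r big1 ?addr0 => [|z zx]; last first.
    by rewrite eq_sym (negbTE zx) mul0r.
  rewrite (bigD1 y) //= eqxx mulr1 big1 ?addr0 // => z /negbTE ->.
  by rewrite mulr0.
rewrite [LHS]/=; under eq_bigr => z _ do
  rewrite -/(occ P pi k.+1 x z) IH mulr_suml.
rewrite exchange_big /=; apply: eq_bigr => z _.
by rewrite mulr_sumr; apply: eq_bigr => w _; rewrite !mulrA.
Qed.

Definition discounted_reward (k : nat) (x : S * A) : R :=
  gamma ^+ k * \sum_y occ P pi k x y * r y.1 y.2.

Lemma discounted_reward0 x : discounted_reward 0 x = r x.1 x.2.
Proof.
rewrite /discounted_reward expr0 mul1r (bigD1 x) //= eqxx mul1r big1 ?addr0 //.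
by move=> y yx; rewrite eq_sym (negbTE yx) mul0r.
Qed.

Lemma discounted_rewardS k x :
  discounted_reward k.+1 x = gamma * policy_step (discounted_reward k) x.
Proof.
rewrite policy_stepE /discounted_reward.
under eq_bigr => y _ do rewrite occ_first_step policy_stepE mulr_suml.
rewrite exchange_big exprS -mulrA; congr (_ * _); rewrite mulr_sumr.
apply: eq_bigr => z _ /=; rewrite mulrCA [in RHS]mulr_sumr; congr (_ * _).
by apply: eq_bigr => y _; rewrite mulrA.
Qed.

Lemma discounted_reward_ge0 k x : 0 <= discounted_reward k x.
Proof.
elim: k x => [|k IH] x.
  by rewrite discounted_reward0; case/andP: (r_bounds x.1 x.2).
rewrite discounted_rewardS mulr_ge0 // policy_stepE; apply: sumr_ge0 => z _.
by apply: mulr_ge0 (IH z); apply: mulr_ge0.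
Qed.

Lemma return_recursion n x :
  series (discounted_reward^~ x) n.+1 = r x.1 x.2
    + gamma * policy_step (fun z => series (discounted_reward^~ z) n) x.
Proof.
rewrite /series /= big_nat_recl // discounted_reward0; congr (_ + _).
under eq_bigr do rewrite discounted_rewardS.
rewrite -mulr_sumr policy_stepE; congr (_ * _).
under eq_bigr do rewrite policy_stepE.
by rewrite exchange_big; apply: eq_bigr => z _; rewrite mulr_sumr.
Qed.

End Policy.

(** By induction on the horizon, truncated returns of every policy stay below [Q], and those of the
    greedy policy come within [gamma ^+ n * H] of it. The supremum is thus attained by a stationary
    deterministic policy. *)
Lemma Qstar_fixpoint Q :
  (forall s a, Q s a = bellman Q s a) -> (forall s a, 0 <= Q s a <= H) ->
  forall s a, Qstar P r gamma s a = Q s a.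
Proof.
move=> Q_fix Q_bounds s a.
have return_le pi : is_policy pi ->
    forall n x, series (discounted_reward pi ^~ x) n <= Q x.1 x.2.
  move=> [pi0 pi1]; elim=> [|n IH] x.
    by rewrite /series /= big_geq //; case/andP: (Q_bounds x.1 x.2).
  rewrite return_recursion Q_fix lerD2l ler_wpM2l //; apply: le_mean => // s'.
  rewrite -(meanC (pi1 s') (vmax a0 Q s')); apply: le_mean => // b.
  exact: le_trans (IH (s', b)) (le_vmax _ _ _ _).
have return_cvg pi : is_policy pi ->
    forall x, cvgn (series (discounted_reward pi ^~ x)).
  move=> pi_pol x; apply: nondecreasing_is_cvgn.
    apply/nondecreasing_seqP => n; rewrite /series /= big_nat_recr //= lerDl.
    exact: discounted_reward_ge0.
  by exists (Q x.1 x.2) => _ [n _ <-]; exact: return_le.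
pose greedy s' a' : R := (a' == [arg max_(b > a0) Q s' b]%O)%:R.
have greedy_mean s' f :
    mean (greedy s') f = f [arg max_(b > a0) Q s' b]%O.
  rewrite /mean (bigD1 [arg max_(b > a0) Q s' b]%O) //= /greedy eqxx mul1r.
  by rewrite big1 ?addr0 // => b /negbTE ->; rewrite mul0r.
have greedy_policy : is_policy greedy.
  split=> [s' a'|s']; first exact: ler0n.
  have := greedy_mean s' (fun=> 1); rewrite /mean => <-.
  by apply: eq_bigr => b _; rewrite mulr1.
have greedy_vmax s' : vmax a0 Q s' <= Q s' [arg max_(b > a0) Q s' b]%O.
  apply: vmax_le => b.
  by case: arg_maxP => // i _ /(_ b isT).
have greedy_ge n x :
    Q x.1 x.2 - gamma ^+ n * H <= series (discounted_reward greedy ^~ x) n.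
  elim: n x => [|n IH] x.
    rewrite /series /= big_geq // expr0 mul1r subr_le0.
    by case/andP: (Q_bounds x.1 x.2).
  rewrite return_recursion Q_fix -addrA lerD2l exprS -mulrA -mulrBr ler_wpM2l //.
  rewrite -[X in _ - X](meanC (P_sum1 x.1 x.2)) -meanB; apply: le_mean => // s'.
  rewrite greedy_mean (le_trans _ (IH (s', _))) // lerD2r; exact: greedy_vmax.
have QpiE pi : Qpi P r gamma pi s a = limn (series (discounted_reward pi ^~ (s, a))).
  by [].
have greedy_opt : Qpi P r gamma greedy s a = Q s a.
  rewrite QpiE; apply: cvg_lim => //.
  apply: (@squeeze_cvgr _ _ _ _ (fun n => Q s a - gamma ^+ n * H) (fun=> Q s a)).
  - by apply: nearW => n; rewrite (greedy_ge n (s, a)) (return_le _ _ n (s, a)).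
  - rewrite -[X in _ --> X]subr0; apply: cvgB; first exact: cvg_cst.
    rewrite -(mul0r H); apply: cvgMl; apply: cvg_expr.
    by rewrite ger0_norm.
  - exact: cvg_cst.
have is_opt : ubound [set q | exists pi, is_policy pi /\ q = Qpi P r gamma pi s a] (Q s a).
  move=> _ [pi [pi_pol ->]]; rewrite QpiE; apply: limr_le; first exact: return_cvg.
  by apply: nearW => n; exact: (return_le _ pi_pol n (s, a)).
apply/le_anti/andP; split.
  by apply: ge_sup => //; exists (Q s a), greedy.
by apply: ub_le_sup; [exists (Q s a) | exists greedy].
Qed.

End Bellman.

(** * Concentration of the innovations *)

Section ProductMeasure.
Variables (R : realType) (K S : finType) (p : K -> S -> R).
Hypotheses (p_ge0 : forall k s, 0 <= p k s) (p_sum1 : forall k, \sum_s p k s = 1).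
Implicit Types (w : {ffun K -> S}) (F G : {ffun K -> S} -> R).

Definition expect F : R :=
  \sum_(w : {ffun K -> S}) (\prod_k p k (w k)) * F w.

Definition update w (k : K) (s : S) : {ffun K -> S} :=
  [ffun j => if j == k then s else w j].

Lemma weight_ge0 w : 0 <= \prod_k p k (w k).
Proof. by apply: prodr_ge0. Qed.

Lemma sum_weight : \sum_(w : {ffun K -> S}) \prod_k p k (w k) = 1.
Proof.
rewrite -(bigA_distr_bigA (fun k s => p k s)) big1 // => k _; exact: p_sum1.
Qed.

Lemma le_expect F G : (forall w, F w <= G w) -> expect F <= expect G.
Proof. by move=> FG; apply: ler_sum => w _; rewrite ler_wpM2l ?weight_ge0. Qed.

Lemma weight_update w k s :
  (\prod_j p j (update w k s j)) * p k (w k) = (\prod_j p j (w j)) * p k s.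
Proof.
rewrite (bigD1 k) //= [in RHS](bigD1 k) //= ffunE eqxx.
rewrite (eq_bigr (fun j => p j (w j))) => [|j /negbTE jk]; last by rewrite ffunE jk.
by ring.
Qed.

(* Exchanging the [k]-th coordinate with an independent copy is an involution
   of the pairs [(w, s)] which preserves their joint weight. *)
Lemma expect_resample k F :
  expect F = expect (fun w => mean (p k) (fun s => F (update w k s))).
Proof.
pose swap (ws : {ffun K -> S} * S) := (update ws.1 k ws.2, ws.1 k).
have swapK : involutive swap.
  move=> [w s]; rewrite /swap /= ffunE eqxx; congr (_, _).
  by apply/ffunP => j; rewrite !ffunE; case: eqP => // ->.
transitivity (\sum_(ws : {ffun K -> S} * S)
    (\prod_j p j (ws.1 j)) * p k ws.2 * F ws.1).
  rewrite /expect -(pair_bigA _ (fun w s => (\prod_j p j (w j)) * p k s * F w)).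
  apply: eq_bigr => w _ /=; rewrite -mulr_suml -mulr_sumr p_sum1 mulr1 //.
rewrite (reindex_inj (inv_inj swapK)) /=.
transitivity (\sum_(ws : {ffun K -> S} * S)
    (\prod_j p j (ws.1 j)) * p k ws.2 * F (update ws.1 k ws.2)).
  by apply: eq_bigr => ws _; rewrite weight_update.
rewrite -(pair_bigA _ (fun w s =>
  (\prod_j p j (w j)) * p k s * F (update w k s))).
apply: eq_bigr => w _ /=; rewrite /mean mulr_sumr.
by apply: eq_bigr => s _; rewrite mulrA.
Qed.

(** Chernoff bound: outside [E] some [F i w] exceeds [l], so the indicator of the complement is at
    most the sum of the [expR (F i w - l)]. *)
Lemma union_bound (I : finType) (F : I -> {ffun K -> S} -> R) (l : R)
    (E : pred {ffun K -> S}) :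
  (forall i, expect (fun w => expR (F i w)) <= 1) ->
  (forall w, (forall i, F i w <= l) -> E w) ->
  1 - #|I|%:R * expR (- l) <= \sum_(w | E w) \prod_k p k (w k).
Proof.
move=> F_le1 F_E; rewrite lerBlDr -[leLHS]sum_weight (bigID E) /= lerD2l.
apply: (@le_trans _ _ (expect (fun w => \sum_i expR (F i w - l)))).
  rewrite /expect big_mkcond /=; apply: ler_sum => w _.
  have sum_ge0 : 0 <= \sum_i expR (F i w - l) by apply: sumr_ge0 => i _; exact: expR_ge0.
  case: ifPn => [/negP notE|_]; last by rewrite mulr_ge0 ?weight_ge0.
  have [i Fi] : exists i, l < F i w.
    apply: contrapT => noF; apply: notE; apply: F_E => i; rewrite leNgt.
    by apply/negP => Fi; apply: noF; exists i.
  rewrite -[leLHS]mulr1 ler_wpM2l ?weight_ge0 // (bigD1 i) //=.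
  rewrite -[leLHS]addr0; apply: lerD; last first.
    by apply: sumr_ge0 => j _; exact: expR_ge0.
  by rewrite -expR0 ler_expR subr_ge0 ltW.
rewrite /expect; under eq_bigr do rewrite mulr_sumr.
rewrite exchange_big /= mulr_natl -sumr_const; apply: ler_sum => i _.
rewrite -[leRHS]mul1r; apply: le_trans (ler_wpM2r (expR_ge0 _) (F_le1 i)).
rewrite /expect mulr_suml ler_sum // => w _.
by rewrite expRD mulrA.
Qed.

End ProductMeasure.

(** * Exponential supermartingale of the averaged noise *)

Section Noise.
Variables (R : realType) (eta : nat -> R).

(** Unrolled, [xi j] has weight [eta j] times the later factors [1 - eta i]. [noise_variance]
    carries the squares of these weights: fed with conditional variances, it is the predictable
    quadratic variation. *)
Fixpoint noise (xi : nat -> R) (k : nat) : R :=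
  if k is j.+1 then (1 - eta j) * noise xi j + eta j * xi j else 0.

Fixpoint noise_variance (v : nat -> R) (k : nat) : R :=
  if k is j.+1 then (1 - eta j) ^+ 2 * noise_variance v j + eta j ^+ 2 * v j
  else 0.

Lemma eq_noise xi xi' k :
  (forall j, (j < k)%N -> xi j = xi' j) -> noise xi k = noise xi' k.
Proof.
elim: k => //= k IH xixi'; rewrite xixi' // IH // => j jk.
by apply: xixi'; exact: ltnW.
Qed.

Lemma eq_noise_variance v v' k :
  (forall j, (j < k)%N -> v j = v' j) -> noise_variance v k = noise_variance v' k.
Proof.
elim: k => //= k IH vv'; rewrite vv' // IH // => j jk.
by apply: vv'; exact: ltnW.
Qed.

Variables (K S : finType) (p : K -> S -> R) (q : S -> R).
Hypotheses (p_ge0 : forall k s, 0 <= p k s) (p_sum1 : forall k, \sum_s p k s = 1).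
Variables (n : nat) (x : nat -> {ffun K -> S} -> S) (V : nat -> {ffun K -> S} -> S -> R).
Variables (gamma H : R).
Hypotheses (gamma_ge0 : 0 <= gamma) (gamma_le1 : gamma <= 1) (H_ge0 : 0 <= H).
Hypothesis eta_bounds : forall k, (k < n)%N -> 0 <= eta k <= 1.
Hypothesis V_bounds : forall k w s, (k < n)%N -> 0 <= V k w s <= H.
(* The [k]-th sample is a fresh coordinate of law [q], which affects neither
   the earlier samples nor the value functions up to time [k]. *)
Hypothesis fresh : forall k, (k < n)%N -> exists c : K,
  [/\ p c =1 q, forall w s, x k (update w c s) = s,
      forall w s j, (j < k)%N -> x j (update w c s) = x j w &
      forall w s j, (j <= k)%N -> V j (update w c s) = V j w].

Definition innovation (w : {ffun K -> S}) (k : nat) : R :=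
  gamma * (V k w (x k w) - mean q (V k w)).

(* The conditional variance is kept random inside the exponential, so no a
   priori bound on the distance of [V] to its limit is needed. *)
Lemma expect_exp_noise_le1 k (lam : R) : (k <= n)%N ->
  (forall j, (j < n)%N -> `|lam| * eta j * H <= 4^-1) ->
  expect p (fun w => expR (lam * noise (innovation w) k
    - lam ^+ 2 * noise_variance (fun j => mvariance q (V j w)) k)) <= 1.
Proof.
elim: k lam => [|k IH] lam kn lam_small.
  rewrite /expect; under eq_bigr do rewrite /= !mulr0 subr0 expR0 mulr1.
  by rewrite sum_weight.
have [c [pc x_new x_old V_old]] := fresh kn.
have q_ge0 s : 0 <= q s by rewrite -pc.
have q_sum1 : \sum_s q s = 1 by rewrite -(p_sum1 c); apply: eq_bigr => s _; rewrite pc.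
have /andP[e0 e1] := eta_bounds kn.
(* The last step damps the past by [1 - eta k], so the induction hypothesis is used at
   [lam * (1 - eta k)]; hence the induction over all [lam]. *)
have lam' : forall j, (j < n)%N -> `|lam * (1 - eta k)| * eta j * H <= 4^-1.
  move=> j jn; apply: le_trans (lam_small j jn).
  have /andP[ej0 _] := eta_bounds jn.
  rewrite -!mulrA normrM -mulrA ler_wpM2l //.
  rewrite ler_piMl ?mulr_ge0 // ger0_norm ?subr_ge0 // lerBlDl lerDr //.
apply: le_trans (IH _ (ltnW kn) lam').
(* Averaging over the fresh coordinate alone plays the role of conditioning on the past. *)
rewrite (expect_resample p_sum1 c); apply: le_expect => // w.
set A := lam * (1 - eta k) * _ - _.
pose y := lam * eta k * gamma.
have exponentE s :
    lam * noise (innovation (update w c s)) k.+1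
      - lam ^+ 2 * noise_variance
          (fun j => mvariance q (V j (update w c s))) k.+1
    = A - (lam * eta k) ^+ 2 * mvariance q (V k w)
      + y * (V k w s - mean q (V k w)).
  rewrite /= (_ : noise (innovation (update w c s)) k = noise (innovation w) k);
    last first.
    apply: eq_noise => j jk; rewrite /innovation x_old // V_old //.
    exact: ltnW.
  rewrite (_ : noise_variance _ k
      = noise_variance (fun j => mvariance q (V j w)) k); last first.
    by apply: eq_noise_variance => j jk; rewrite V_old // ltnW.
  rewrite /innovation x_new V_old // /A /y; ring.
have -> : mean (p c) (fun s => expR (lam * noise (innovation (update w c s)) k.+1
      - lam ^+ 2 * noise_variance
          (fun j => mvariance q (V j (update w c s))) k.+1))
    = expR (A - (lam * eta k) ^+ 2 * mvariance q (V k w))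
      * mean q (fun s => expR (y * (V k w s - mean q (V k w)))).
  rewrite -meanZ; apply: eq_bigr => s _.
  by rewrite exponentE expRD pc.
have y_small s : `|y * (V k w s - mean q (V k w))| <= 4^-1.
  apply: le_trans (lam_small k kn).
  rewrite normrM /y normrM normrM (ger0_norm e0) (ger0_norm gamma_ge0).
  rewrite -!mulrA !ler_wpM2l // -[leRHS]mul1r ler_pM //.
  have /andP[V0 VH] := V_bounds w s kn.
  have /andP[m0 mH] := mean_bounds q_ge0 q_sum1 (fun s' => V_bounds w s' kn).
  by rewrite ler_norml; apply/andP; split; lra.
(* The new sample costs [y ^+ 2] times the conditional variance, which the compensator covers since
   [gamma <= 1]. *)
apply: le_trans (ler_wpM2l (expR_ge0 _) (mean_expR_le q_ge0 q_sum1 y_small)) _.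
rewrite -expRD ler_expR -lerBrDl opprB [leRHS]addrC subrK.
apply: ler_wpM2r; first exact: mvariance_ge0.
rewrite /y exprMn ler_piMr ?sqr_ge0 // expr_le1 //.
Qed.

End Noise.

(** * The iterates on the good event *)

Section Tracking.
Variables (R : realType) (S A : finType) (a0 : A).
Variables (P : S -> A -> S -> R) (r : S -> A -> R) (gamma : R).
Hypotheses (P_kernel : is_kernel P) (r_bounds : forall s a, 0 <= r s a <= 1).
Hypotheses (gamma_ge_half : 2^-1 <= gamma) (gamma_lt1 : gamma < 1).

Local Notation H := (1 - gamma)^-1.

Let P_ge0 s a s' : 0 <= P s a s'. Proof. by case: P_kernel. Qed.
Let P_sum1 s a : \sum_s' P s a s' = 1. Proof. by case: P_kernel. Qed.
Let gamma_ge0 : 0 <= gamma. Proof. by rewrite (le_trans _ gamma_ge_half). Qed.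
Let h_gt0 : 0 < 1 - gamma. Proof. by rewrite subr_gt0. Qed.
Let h_le1 : 1 - gamma <= 1. Proof. by rewrite lerBlDl lerDr. Qed.
Let H_ge1 : 1 <= H.
Proof. by rewrite -[leLHS]invr1 lef_pV2 ?posrE // lerBlDl lerDr. Qed.
Let H_ge0 : 0 <= H. Proof. exact: le_trans H_ge1. Qed.

Lemma Qlearn_bounds (eta : nat -> R) (Q0 : S -> A -> R) samp t :
  (forall k, (k <= t)%N -> 0 <= eta k <= 1) ->
  (forall s a, 0 <= Q0 s a <= H) ->
  forall s a, 0 <= Qlearn a0 r gamma eta Q0 samp t s a <= H.
Proof.
move=> eta_bounds Q0_bounds; elim: t eta_bounds => //= t IH eta_bounds s a.
have {}IH : forall s a, 0 <= Qlearn a0 r gamma eta Q0 samp t s a <= H.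
  by apply: IH => k kt; apply: eta_bounds; exact: leqW.
have /andP[e0 e1] := eta_bounds _ (leqnn t.+1).
have /andP[r0 r1] := r_bounds s a.
have /andP[q0 q1] := IH s a.
have [b ->] := vmax_attained a0 (Qlearn a0 r gamma eta Q0 samp t) (samp t.+1 s a).
have /andP[v0 v1] := IH (samp t.+1 s a) b.
have target_le : r s a + gamma * Qlearn a0 r gamma eta Q0 samp t (samp t.+1 s a) b <= H.
  by rewrite -[leRHS](horizon_eq gamma_lt1) lerD // ler_wpM2l.
have target_ge0 : 0 <= r s a + gamma * Qlearn a0 r gamma eta Q0 samp t (samp t.+1 s a) b.
  by rewrite addr_ge0 // mulr_ge0.
apply/andP; split; first by rewrite addr_ge0 // mulr_ge0 // subr_ge0.
have -> : H = (1 - eta t.+1) * H + eta t.+1 * H by ring.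
by apply: lerD; apply: ler_wpM2l; rewrite ?subr_ge0.
Qed.

Variables (Qs : S -> A -> R).
Hypotheses (Qs_fix : forall s a, Qs s a = bellman a0 P r gamma Qs s a).
Hypotheses (Qs_bounds : forall s a, 0 <= Qs s a <= H).
Local Notation Vs := (vmax a0 Qs).
Local Notation VarVs s a := (mvariance (P s a) Vs).

Lemma Vs_bounds s : 0 <= Vs s <= H.
Proof. by have [a ->] := vmax_attained a0 Qs s. Qed.

(** Square the Bellman equation with [w = mean (P s a) Vs]: the part [r * (r + 2 gamma w)] is at
    most [2 H] because [r <= 1] and both [r + gamma w] and [gamma w] are at most [H]. In the rest,
    [gamma ^+ 2 <= gamma], and [w ^+ 2] is the second moment minus the variance. *)
Lemma Qs_sqr_le s a :
  Qs s a ^+ 2 <= 2 * H + gamma * mean (P s a) (fun s' => Vs s' ^+ 2)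
                 - gamma * VarVs s a.
Proof.
rewrite mean_sqr // mulrDr.
have /andP[q0 qH] := Qs_bounds s a; have /andP[r0 r1] := r_bounds s a.
have /andP[w0 wH] := mean_bounds (P_ge0 s a) (P_sum1 s a) Vs_bounds.
move: q0 qH; rewrite Qs_fix /bellman; set w := mean _ _ in w0 wH *.
set v := mvariance _ _ => q0 qH.
have l1 : r s a * (r s a + 2 * (gamma * w)) <= 2 * H.
  have rw0 : 0 <= r s a + 2 * (gamma * w) by rewrite addr_ge0 ?mulr_ge0.
  have gw0 : 0 <= gamma * w by rewrite mulr_ge0.
  apply: (@le_trans _ _ (1 * (r s a + 2 * (gamma * w)))); first exact: ler_wpM2r.
  by lra.
have l2 : gamma ^+ 2 * w ^+ 2 <= gamma * w ^+ 2.
  by rewrite ler_wpM2r ?sqr_ge0 // expr2 ler_piMl // ltW.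
have -> : (r s a + gamma * w) ^+ 2
    = r s a * (r s a + 2 * (gamma * w)) + gamma ^+ 2 * w ^+ 2 by ring.
lra.
Qed.

(* [q - c q^2] increases on [[0, 1 / (2 c)]], so an envelope of the form
   [m - c Q^2] passes from action values to their maxima. *)
Lemma vmax_envelope (Q : S -> A -> R) (m c : R) :
  0 <= c -> 2 * c * H <= 1 ->
  (forall s a, `|Q s a - Qs s a| <= m - c * Qs s a ^+ 2) ->
  forall s, `|vmax a0 Q s - Vs s| <= m - c * Vs s ^+ 2.
Proof.
move=> c0 cH QQs s; rewrite ler_norml; apply/andP; split.
  have [b Vb] := vmax_attained a0 Qs s.
  have := QQs s b; rewrite ler_norml -Vb => /andP[+ _].
  have := le_vmax a0 Q s b; lra.
(* The maximiser [b] of [Q] need not maximise [Qs]; only this side needs the monotonicity of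
   [q - c q^2]. *)
have [b ->] := vmax_attained a0 Q s.
have := QQs s b; rewrite ler_norml => /andP[_].
have qv := le_vmax a0 Qs s b.
have /andP[q0 qH] := Qs_bounds s b; have /andP[v0 vH] := Vs_bounds s.
have : c * (Vs s + Qs s b) <= 1.
  apply: le_trans cH; rewrite [2 * c]mulrC -mulrA ler_wpM2l //; lra.
rewrite -subr_ge0 => c_le; move: qv; rewrite -subr_ge0 => qv.
have := mulr_ge0 qv c_le.
have -> : (Vs s - Qs s b) * (1 - c * (Vs s + Qs s b))
  = Vs s - Qs s b - (c * Vs s ^+ 2 - c * Qs s b ^+ 2) by ring.
lra.
Qed.

Variables (n : nat) (eta : nat -> R) (Q : nat -> S -> A -> R).
Variables (x : nat -> S -> A -> S) (eps eb l : R).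
Hypotheses (eps_gt0 : 0 < eps) (eps_le1 : eps <= 1) (eb_gt0 : 0 < eb).
Hypothesis Q_rec : forall k s a, (k < n)%N -> Q k.+1 s a =
  (1 - eta k) * Q k s a + eta k * (r s a + gamma * vmax a0 (Q k) (x k s a)).
Hypothesis eta_bounds : forall k, (k < n)%N -> 0 <= eta k <= 1.
Hypothesis eta_le : forall k, (k < n)%N -> eta k <= eb.
Hypothesis Q0_bounds : forall s a, 0 <= Q 0 s a <= H.

Local Notation innov s a := (fun k =>
  gamma * (vmax a0 (Q k) (x k s a) - mean (P s a) (vmax a0 (Q k)))).
Local Notation N k s a := (noise eta (innov s a) k).
Local Notation NV k s a :=
  (noise_variance eta (fun j => mvariance (P s a) (vmax a0 (Q j))) k).

(** [alpha * H ^+ 2 = eps / 32] keeps the quadratic terms below a fraction of [eps];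
    [lam * (4 * eb) = alpha] turns the bound on [NV] into [alpha] times a variance; [rho], the cost
    of the union bound, is at most [eps * (1 - gamma) / 4]. *)
Variables (alpha lam rho : R).
Hypotheses (alphaE : alpha = eps * (1 - gamma) ^+ 2 / 32).
Hypotheses (lamE : lam = alpha / (4 * eb)) (rhoE : rho = l / lam).

Hypothesis l_small : 512 * l * eb * H ^+ 3 <= eps ^+ 2.
Hypothesis good : forall k s a, (k <= n)%N -> `|N k s a| <= lam * NV k s a + rho.

(** Only half of the contraction [1 - gamma] is spent on decay; the other half pays for the noise.
    The initial [3 * H] covers both the initial error and the slack. *)
Definition radius (k : nat) : R :=
  eps / 2 + 3 * H * \prod_(j < k) (1 - eta j * ((1 - gamma) / 2)).

Let alpha_gt0 : 0 < alpha.
Proof. by rewrite alphaE !mulr_gt0 // exprn_gt0. Qed.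

Let alphaH : 32 * (alpha * H) = eps * (1 - gamma).
Proof. by rewrite alphaE; field; rewrite gt_eqF. Qed.

Let alphaHH : 32 * (alpha * H ^+ 2) = eps.
Proof. by rewrite alphaE; field; rewrite gt_eqF. Qed.

Let rho_le : 4 * rho <= eps * (1 - gamma).
Proof.
have -> : 4 * rho = (512 * l * eb * H ^+ 3) / eps * (1 - gamma).
  by rewrite rhoE lamE alphaE; field; rewrite !gt_eqF.
rewrite ler_pM2r // ler_pdivrMr // -expr2 //.
Qed.

Let lam_gt0 : 0 < lam.
Proof. by rewrite lamE divr_gt0 // mulr_gt0. Qed.

Let factor_bounds k : (k < n)%N -> 0 <= 1 - eta k * ((1 - gamma) / 2) <= 1.
Proof.
move=> /eta_bounds/andP[e0 e1].
have d0 : 0 <= (1 - gamma) / 2 by rewrite divr_ge0 // ltW.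
have := mulr_ge0 e0 d0; have := ler_piMl d0 e1; have := gamma_ge0.
by move=> *; apply/andP; split; lra.
Qed.

Let prod_bounds k : (k <= n)%N ->
  0 <= \prod_(j < k) (1 - eta j * ((1 - gamma) / 2)) <= 1.
Proof.
elim: k => [|k IH] kn; first by rewrite big_ord0 ler01 lexx.
rewrite big_ord_recr /=; have /andP[p0 p1] := IH (ltnW kn).
have /andP[f0 f1] := factor_bounds kn.
by rewrite mulr_ge0 // mulr_ile1.
Qed.

Let radius_bounds k : (k <= n)%N -> eps / 2 <= radius k <= 4 * H.
Proof.
move=> kn; have /andP[p0 p1] := prod_bounds kn.
have H1 := H_ge1; rewrite /radius; set pr := \prod_(j < k) _ in p0 p1 *.
apply/andP; split.
  by rewrite lerDl mulr_ge0 // mulr_ge0.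
have : 3 * H * pr <= 3 * H * 1.
  by rewrite ler_wpM2l // mulr_ge0.
by move: eps_le1 H1; set h := H; lra.
Qed.

Lemma radiusS k :
  radius k.+1 = radius k - eta k * ((1 - gamma) / 2) * (radius k - eps / 2).
Proof. by rewrite /radius big_ord_recr /=; ring. Qed.

(* The last three terms dominate the noise [N k s a]; the first one is the
   Lyapunov function whose drift absorbs [alpha * VarVs s a]. *)
Let slack k s a : R :=
  2 * alpha * Qs s a ^+ 2 + alpha * VarVs s a
    + 4 * (alpha * H) * radius k + rho.

(** Puts the noise back: on the good event it costs exactly the last three terms of [slack]. *)
Let envelope k s a : (k <= n)%N ->
  `|Q k s a - Qs s a - N k s a| <= radius k - slack k s a ->
  NV k s a <= 4 * eb * (VarVs s a + 4 * H * radius k) ->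
  `|Q k s a - Qs s a| <= radius k - 2 * alpha * Qs s a ^+ 2.
Proof.
move=> kn D_le NV_le.
have N_le : `|N k s a| <= alpha * (VarVs s a + 4 * H * radius k) + rho.
  apply: le_trans (good s a kn) _; rewrite lerD2r.
  have -> : alpha = lam * (4 * eb).
    by rewrite lamE mulfVK // mulf_neq0 // ?gt_eqF.
  by rewrite -mulrA ler_wpM2l // ltW.
rewrite -[Q k s a - Qs s a](subrK (N k s a)).
apply: le_trans (ler_normD _ _) _; apply: le_trans (lerD D_le N_le) _.
by rewrite /slack; lra.
Qed.

(** The two bounds must be proved together: at time [k] they give the envelope for the values, which
    controls both the next noise-free error and the next conditional variance. *)
Let invariant k : (k <= n)%N -> forall s a,
  `|Q k s a - Qs s a - N k s a| <= radius k - slack k s a /\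
  NV k s a <= 4 * eb * (VarVs s a + 4 * H * radius k).
Proof.
elim: k => [|k IH] kn s a.
  have /andP[m_lo m_hi] := radius_bounds kn.
  have H1 := H_ge1; split; last first.
    rewrite mulr_ge0 ?(ltW eb_gt0) // ?mulr_ge0 ?(ltW eb_gt0) //.
    rewrite addr_ge0 ?mvariance_ge0 // mulr_ge0 // ?mulr_ge0 //.
    by rewrite (le_trans _ m_lo) // divr_ge0 // ltW.
  (* Initially the slack is below [eps <= H], and the error is at most [H], so [3 * H] suffices. *)
  rewrite /slack subr0.
  have q_sqr : alpha * Qs s a ^+ 2 <= alpha * H ^+ 2.
    have /andP[q0 qH] := Qs_bounds s a.
    by rewrite ler_wpM2l ?(ltW alpha_gt0) // lerXn2r // nnegrE (le_trans q0).
  have var_sqr : alpha * VarVs s a <= alpha * H ^+ 2.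
    rewrite ler_wpM2l ?(ltW alpha_gt0) //.
    by apply: mvariance_le_sqr => //; exact: Vs_bounds.
  have radius_term : alpha * H * radius 0 <= alpha * H * (4 * H).
    by rewrite ler_wpM2l // mulr_ge0 ?(ltW alpha_gt0).
  have eps_h : eps * (1 - gamma) <= eps.
    by rewrite ler_piMr ?(ltW eps_gt0).
  have Q0Qs : `|Q 0 s a - Qs s a| <= H.
    have /andP[q0 qH] := Qs_bounds s a; have /andP[q0' qH'] := Q0_bounds s a.
    by rewrite ler_norml; apply/andP; split; lra.
  have radius0 : radius 0 = eps / 2 + 3 * H by rewrite /radius big_ord0 mulr1.
  have := alphaHH; have := rho_le; move: radius_term; rewrite radius0.
  have -> : alpha * H * (4 * H) = 4 * (alpha * H ^+ 2) by ring.
  lra.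
have {}IH := IH (ltnW kn).
have /andP[m_lo m_hi] := radius_bounds (ltnW kn).
have /andP[e0 e1] := eta_bounds kn.
have V_env s' : `|vmax a0 (Q k) s' - Vs s'| <= radius k - 2 * alpha * Vs s' ^+ 2.
  apply: vmax_envelope => [||{}s {}a].
  - by rewrite mulr_ge0 // ltW.
  - have := alphaH; have := h_gt0; have : eps * (1 - gamma) <= 1 * 1.
      by rewrite ler_pM ?(ltW eps_gt0) ?(ltW h_gt0).
    lra.
  - by case: (IH s a); exact: envelope (ltnW kn).
have [D_le NV_le] := IH s a.
have radius_le : radius k.+1 <= radius k.
  by rewrite radiusS lerBlDr lerDl !mulr_ge0 ?subr_ge0 // ltW.
have radius_ge0 : 0 <= radius k by rewrite (le_trans _ m_lo) // divr_ge0 // ltW.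
split; last first.
  (* The squared radius is made linear by [radius k <= 4 * H]. *)
  have var_le : mvariance (P s a) (vmax a0 (Q k)) <= 2 * (VarVs s a + 4 * H * radius k).
    have -> : 2 * (VarVs s a + 4 * H * radius k)
      = 2 * VarVs s a + 2 * (4 * H * radius k) by ring.
    apply: le_trans (mvariance_perturb (P_ge0 s a) (P_sum1 s a) (m := radius k) _) _.
      move=> s'; apply: le_trans (V_env s') _.
      by rewrite lerBlDr lerDl mulr_ge0 ?sqr_ge0 // mulr_ge0 // ltW.
    by rewrite lerD2l ler_wpM2l // expr2 ler_wpM2r.
  set Y := VarVs s a + 4 * H * radius k in NV_le var_le.
  (* The radius shrinks slowly, as [(1 - gamma) / 2 <= 1/4]; the averaged variance forgets its past
     faster and so stays below the moving bound. *)
  have Y_le : (1 - eta k / 4) * Y <= VarVs s a + 4 * H * radius k.+1.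
    have drop_le : eta k * ((1 - gamma) / 2) * (radius k - eps / 2)
        <= eta k * 4^-1 * radius k.
      apply: ler_pM; rewrite ?mulr_ge0 ?divr_ge0 ?(ltW h_gt0) ?subr_ge0 //.
        by rewrite ler_wpM2l //; have := gamma_ge_half; lra.
      by rewrite lerBlDr lerDl divr_ge0 // ltW.
    have := ler_wpM2l H_ge0 drop_le.
    have := mulr_ge0 e0 (mvariance_ge0 (P_ge0 s a) Vs).
    rewrite radiusS /Y; move: (H) (VarVs s a) (radius k) => h v m.
    lra.
  rewrite [leLHS]/=.
  have NV_part := ler_wpM2l (sqr_ge0 (1 - eta k)) NV_le.
  have Y_ge0 : 0 <= Y.
    by rewrite addr_ge0 ?mvariance_ge0 // mulr_ge0 // mulr_ge0.
  have var_part : eta k ^+ 2 * mvariance (P s a) (vmax a0 (Q k))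
      <= eta k * eb * (2 * Y).
    apply: ler_pM; rewrite ?sqr_ge0 ?mvariance_ge0 // expr2 ler_wpM2l //.
    exact: eta_le.
  apply: le_trans (lerD NV_part var_part) _.
  have eb_ge0 : 0 <= 4 * eb by rewrite mulr_ge0 // ltW.
  apply: le_trans (ler_wpM2l eb_ge0 Y_le).
  have -> : (1 - eta k) ^+ 2 * (4 * eb * Y) + eta k * eb * (2 * Y)
      = 4 * eb * (((1 - eta k) ^+ 2 + eta k / 2) * Y) by field.
  (* On [[0, 1]], [(1 - e)^2 + e / 2 <= 1 - e / 4]. *)
  rewrite ler_wpM2l // ler_wpM2r //; nra.
pose W2 := mean (P s a) (fun s' => Vs s' ^+ 2).
pose M := mean (P s a) (vmax a0 (Q k)) - mean (P s a) Vs.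
have M_le : `|M| <= radius k - 2 * alpha * W2.
  have -> : radius k - 2 * alpha * W2
      = mean (P s a) (fun s' => radius k - 2 * alpha * Vs s' ^+ 2).
    by rewrite meanB meanC // meanZ.
  rewrite ler_norml /M -meanB; apply/andP; split.
    rewrite -[leLHS]mulN1r -meanZ; apply: le_mean => // s'.
    by have := V_env s'; rewrite ler_norml mulN1r => /andP[].
  apply: le_mean => // s'.
  by have := V_env s'; rewrite ler_norml => /andP[].
(* Subtracting the noise cancels the innovation: only the conditional mean error [M] drives the
   recursion. *)
have -> : Q k.+1 s a - Qs s a - N k.+1 s a
    = (1 - eta k) * (Q k s a - Qs s a - N k s a) + eta k * (gamma * M).
  by rewrite Q_rec // Qs_fix /bellman /M /=; ring.
apply: (@le_trans _ _ ((1 - eta k) * (radius k - slack k s a)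
    + eta k * (gamma * (radius k - 2 * alpha * W2)))).
  apply: le_trans (ler_normD _ _) _; rewrite !normrM.
  rewrite (ger0_norm e0) (ger0_norm gamma_ge0) ger0_norm ?subr_ge0 //.
  by apply: lerD; apply: ler_wpM2l => //; rewrite ?subr_ge0 // ler_wpM2l.
have q_sqr := ler_wpM2l (ltW alpha_gt0) (Qs_sqr_le s a).
(* As [gamma >= 1/2], the drift of [2 * alpha * Qs ^+ 2] absorbs the variance term of the slack. *)
have v_le : alpha * VarVs s a <= 2 * gamma * (alpha * VarVs s a).
  apply: ler_peMl; first exact: mulr_ge0 (ltW alpha_gt0) (mvariance_ge0 _ _).
  by have := gamma_ge_half; lra.
have c_radius : 32 * (alpha * H * radius k) <= (1 - gamma) * radius k.
  rewrite mulrA alphaH ler_wpM2r // ler_piMl //; exact: ltW.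
have c_ge0 : 0 <= alpha * H by rewrite mulr_ge0 // ltW.
have := mulr_ge0 c_ge0 (_ : 0 <= radius k - radius k.+1).
rewrite subr_ge0 => /(_ radius_le).
have h_radius := ler_wpM2l (ltW h_gt0) m_lo.
(* The margin in the induction step is [eta k] times this bracket plus [4 * alpha * H] times the
   decrease of the radius. The floor [radius k >= eps / 2] pays for [rho] and for the [2 * H] of
   [Qs_sqr_le]. *)
have bracket_ge0 : 0 <= (1 - gamma) * radius k - 2 * (alpha * Qs s a ^+ 2)
    - alpha * VarVs s a - 4 * (alpha * H * radius k) - rho
    + 2 * alpha * gamma * W2 - (1 - gamma) / 2 * (radius k - eps / 2).
  have := mulr_ge0 (ltW eps_gt0) (ltW h_gt0).
  move: rho_le alphaH q_sqr v_le c_radius h_radius.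
  rewrite -/W2; move: (H) (W2) (VarVs s a) (Qs s a) (radius k) (rho) (alpha).
  move=> h w v q m rh al; lra.
have := mulr_ge0 e0 bracket_ge0.
rewrite /slack radiusS.
move: (H) (W2) (VarVs s a) (Qs s a) (radius k) (rho) (alpha) (eta k).
move=> h w v q m rh al e; lra.
Qed.

Lemma tracking_error s a : `|Q n s a - Qs s a| <= radius n.
Proof.
have [D_le NV_le] := invariant (leqnn n) s a.
apply: le_trans (envelope (leqnn n) D_le NV_le) _.
by rewrite lerBlDr lerDl mulr_ge0 ?sqr_ge0 // mulr_ge0 // ltW.
Qed.

End Tracking.

(** * The main estimate *)

Lemma prod_decay (R : realType) (n : nat) (f : nat -> R) (d : R) :
  (forall j, (j < n)%N -> d <= f j <= 1) ->
  \prod_(j < n) (1 - f j) <= expR (- (n%:R * d)).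
Proof.
move=> fd; apply: (@le_trans _ _ (\prod_(j < n) expR (- d))).
  apply: ler_prod => j _; have /andP[d_le f_le1] := fd j (ltn_ord j).
  rewrite subr_ge0 f_le1 /=; apply: le_trans (expR_ge1Dx _).
  by rewrite lerD2l lerN2.
by rewrite prodr_const card_ord -expRM_natl mulrN.
Qed.

(** * Dependence of the iterates on the sample coordinates *)

Section Samples.
Variables (R : realType) (S A : finType) (a0 : A) (T : nat).
Implicit Types (w : {ffun 'I_T * S * A -> S}) (i : 'I_T).

Lemma sample_of_update_new w i s a z :
  sample_of (update w (i, s, a) z) i.+1 s a = z.
Proof. by rewrite /sample_of /= valK ffunE eqxx. Qed.

Lemma sample_of_update_old w i s a z t : t != i.+1 ->
  sample_of (update w (i, s, a) z) t = sample_of w t.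
Proof.
move=> ti; apply/funext => s'; apply/funext => a'; rewrite /sample_of.
case: insubP => // j _ jt; case: t ti jt => //= t ti jt.
rewrite ffunE; case: eqP => // -[ji _ _].
by move: ti; rewrite -jt ji eqxx.
Qed.

(** Adaptedness: this makes the coordinates of later iterations fresh for the current values. *)
Lemma eq_Qlearn (r : S -> A -> R) gamma eta Q0 (x y : nat -> S -> A -> S) t :
  (forall u, (u <= t)%N -> x u = y u) ->
  Qlearn a0 r gamma eta Q0 x t = Qlearn a0 r gamma eta Q0 y t.
Proof.
elim: t => //= t IH xy; rewrite xy // IH // => u ut.
by apply: xy; exact: leqW.
Qed.

End Samples.

Section HighProbability.
Variables (R : realType) (S A : finType) (a0 : A).
Variables (P : S -> A -> S -> R) (r : S -> A -> R) (gamma : R).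
Hypotheses (P_kernel : is_kernel P) (r_bounds : forall s a, 0 <= r s a <= 1).
Hypotheses (gamma_ge_half : 2^-1 <= gamma) (gamma_lt1 : gamma < 1).
Variables (eta : nat -> R) (Q0 : S -> A -> R) (T tau : nat).
Variables (eps eb lo l : R).
Hypotheses (tau_le : (tau <= T)%N).
Hypothesis eta_bounds : forall t, (t <= T)%N -> 0 <= eta t <= 1.
Hypothesis eta_tail : forall t, (tau < t <= T)%N -> lo <= eta t <= eb.
Hypotheses (eb_gt0 : 0 < eb) (eps_gt0 : 0 < eps) (eps_le1 : eps <= 1).
Hypothesis Q0_bounds : forall s a, 0 <= Q0 s a <= (1 - gamma)^-1.
Hypothesis l_small : 512 * l * eb * (1 - gamma)^-1 ^+ 3 <= eps ^+ 2.
Hypothesis burn_in : 3 * (1 - gamma)^-1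
  * expR (- ((T - tau)%:R * (lo * ((1 - gamma) / 2)))) <= eps / 2.

Local Notation H := (1 - gamma)^-1.
Local Notation Om := {ffun 'I_T * S * A -> S}.
Local Notation n := (T - tau)%N.

(** The clock restarts at [tau], where nothing but [0 <= Q <= H] is known. The union bound runs over
    the [n.+1] times, all pairs and two signs. *)
Lemma Qlearn_error_probability :
  1 - (2 * (n.+1 * #|S| * #|A|))%:R * expR (- l) <=
  Prob P (fun w : Om => \big[Num.max/0]_(x : S * A)
    `|Qlearn a0 r gamma eta Q0 (sample_of w) T x.1 x.2
      - Qstar P r gamma x.1 x.2| <= eps).
Proof.
have gamma_ge0 : 0 <= gamma by rewrite (le_trans _ gamma_ge_half).
have h_gt0 : 0 < 1 - gamma by rewrite subr_gt0.
have H_gt0 : 0 < H by rewrite invr_gt0.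
have [Qs [Qs_fix Qs_bounds]] := bellman_fixpoint a0 P_kernel r_bounds gamma_ge0 gamma_lt1.
pose Q (w : Om) k := Qlearn a0 r gamma eta Q0 (sample_of w) (k + tau)%N.
pose V k (w : Om) := vmax a0 (Q w k).
(* The passage from [Q w k] to [Q w k.+1] is iteration [k + tau + 1]. *)
pose eta' k := eta (k + tau).+1.
have lt_T k : (k < n)%N -> (k + tau < T)%N by rewrite ltn_subRL addnC.
have eta'_bounds k : (k < n)%N -> 0 <= eta' k <= 1.
  by move=> /lt_T kT; exact: eta_bounds.
have eta'_tail k : (k < n)%N -> lo <= eta' k <= eb.
  by move=> /lt_T kT; apply: eta_tail; rewrite kT andbT ltnS leq_addl.
have Q_bounds w k s a : (k <= n)%N -> 0 <= Q w k s a <= H.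
  move=> kn; apply: Qlearn_bounds => // t tk; apply: eta_bounds.
  by apply: leq_trans tk _; rewrite -(subnK tau_le) leq_add2r.
pose innov s a (w : Om) k := gamma * (V k w (sample_of w (k + tau).+1 s a)
  - mean (P s a) (V k w)).
pose var s a (w : Om) k := mvariance (P s a) (V k w).
pose alpha := eps * (1 - gamma) ^+ 2 / 32.
pose lam := alpha / (4 * eb).
have alpha_gt0 : 0 < alpha by rewrite divr_gt0 // mulr_gt0 // exprn_gt0.
have lam_gt0 : 0 < lam by rewrite divr_gt0 // mulr_gt0.
(* Using both [lam] and [- lam] makes the noise bound two-sided. *)
pose sgn (b : bool) : R := (-1) ^+ b.
pose F (i : 'I_n.+1 * S * A * bool) (w : Om) :=
  let: (k, s, a, b) := i in
  (sgn b * lam) * noise eta' (innov s a w) k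
  - (sgn b * lam) ^+ 2 * noise_variance eta' (var s a w) k.
have -> : (2 * (n.+1 * #|S| * #|A|))%N = #|{: 'I_n.+1 * S * A * bool}|.
  by rewrite !card_prod card_ord card_bool mulnC.
have [P_ge0 P_sum1] := P_kernel.
apply: (@union_bound _ _ _ (fun k : 'I_T * S * A => P k.1.2 k.2) _ _ _ F) => //.
  move=> [[[k s] a] b]; rewrite /F.
  apply: (@expect_exp_noise_le1 _ eta' _ _ _ (P s a) _ _ n
    (fun k w => sample_of w (k + tau).+1 s a) V gamma H) => //.
  - exact: ltW.
  - exact: ltW.
  - move=> j w s' jn; rewrite /V.
    by have [c ->] := vmax_attained a0 (Q w j) s'; apply: Q_bounds; exact: ltnW.
  - move=> j jn; exists (Ordinal (lt_T j jn), s, a); split => //.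
    + by move=> w s'; rewrite -[X in sample_of _ X]/((Ordinal (lt_T j jn)).+1) sample_of_update_new.
    + move=> w s' i ij; rewrite sample_of_update_old //=.
      by rewrite eqSS eqn_add2r ltn_eqF.
    + move=> w s' i ij; rewrite /V /Q; congr vmax; apply: eq_Qlearn => u ui.
      rewrite sample_of_update_old //= ltn_eqF // ltnS (leq_trans ui) //.
      by rewrite leq_add2r.
  - by rewrite -ltnS.
  - move=> j jn; have /andP[_ e_le] := eta'_tail j jn.
    have /andP[e0 _] := eta'_bounds j jn.
    rewrite normrM normrX normrN1 expr1n mul1r gtr0_norm //.
    apply: (@le_trans _ _ (lam * eb * H)).
      by rewrite ler_pM2r // ler_pM2l.
    have -> : lam * eb * H = eps * (1 - gamma) / 128.
      by rewrite /lam /alpha; field; rewrite !gt_eqF.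
    have : eps * (1 - gamma) <= 1 * 1.
      by rewrite ler_pM ?(ltW eps_gt0) ?(ltW h_gt0) // lerBlDl lerDr.
    lra.
move=> w F_le.
apply: (big_ind (fun y => y <= eps)) => [|y z ye ze|[s a] _ /=]; first exact: ltW.
  by rewrite ge_max ye ze.
rewrite (Qstar_fixpoint P_kernel r_bounds gamma_ge0 gamma_lt1 Qs_fix Qs_bounds).
have good k s' a' : (k <= n)%N -> `|noise eta' (innov s' a' w) k|
    <= lam * noise_variance eta' (var s' a' w) k + l / lam.
  move=> kn.
  have k_lt : (k < n.+1)%N by rewrite ltnS.
  have up := F_le (Ordinal k_lt, s', a', false).
  have dn := F_le (Ordinal k_lt, s', a', true).
  move: up dn; rewrite /F /sgn /= expr0 expr1 mul1r mulN1r sqrrN.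
  set Nk := noise _ _ _; set NVk := noise_variance _ _ _ => up dn.
  rewrite -(ler_pM2l lam_gt0) mulrDr [lam * (l / lam)]mulrC divfK ?gt_eqF //.
  rewrite -[lam in X in X <= _](gtr0_norm lam_gt0) -normrM ler_norml.
  by apply/andP; split; lra.
have Q_rec k s' a' : (k < n)%N -> Q w k.+1 s' a' = (1 - eta' k) * Q w k s' a'
    + eta' k * (r s' a' + gamma * vmax a0 (Q w k) (sample_of w (k + tau).+1 s' a')).
  by [].
have := tracking_error P_kernel r_bounds gamma_ge_half gamma_lt1 Qs_fix Qs_bounds
  eps_gt0 eps_le1 eb_gt0 Q_rec eta'_bounds
  (fun k kn => proj2 (andP (eta'_tail k kn)))
  (fun s a => Q_bounds w 0%N s a (leq0n _)) erefl erefl erefl l_small good s a.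
rewrite /Q subnK // => /le_trans; apply.
rewrite /radius; rewrite [leRHS]splitr.
rewrite lerD2l.
apply: le_trans _ burn_in; rewrite ler_wpM2l ?mulr_ge0 // ?(ltW H_gt0) //.
apply: (prod_decay (f := fun j => eta' j * ((1 - gamma) / 2))) => j jn; have /andP[e_lo _] := eta'_tail j jn.
have /andP[e0 e1] := eta'_bounds j jn.
have d_ge0 : 0 <= (1 - gamma) / 2 by rewrite divr_ge0 // ltW.
rewrite ler_wpM2r //= (le_trans (ler_piMl d_ge0 e1)) //; lra.
Qed.

End HighProbability.

Lemma ln2_ge_half (R : realType) : 2^-1 <= ln (2 : R).
Proof.
have : ln (1 + - 2^-1 : R) <= - 2^-1 by apply: le_ln1Dx; lra.
have -> : (1 + - 2^-1 : R) = 2^-1 by field.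
by rewrite lnV ?posrE // lerN2.
Qed.

Theorem theorem2 (R : realType) :
  exists c0 : R, 0 < c0 /\
  forall c1 c2 : R, 0 < c2 -> c2 <= c1 -> c1 <= c0 ->
  exists c3 : R, 0 < c3 /\
  forall (S A : finType) (a0 : A) (P : S -> A -> S -> R) (r : S -> A -> R)
         (gamma delta eps : R) (eta : nat -> R) (T : nat) (Q0 : S -> A -> R),
    is_kernel P ->
    (forall s a, 0 <= r s a <= 1) ->
    0 < delta < 1 -> 0 < eps <= 1 -> 2^-1 <= gamma < 1 ->
    (1 < T)%N ->
    (forall t : nat, (t <= T)%N ->
       1 / (1 + c1 * (1 - gamma) * T%:R / ln T%:R ^+ 3) <= eta t
       <= 1 / (1 + c2 * (1 - gamma) * t%:R / ln T%:R ^+ 3)) ->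
    c3 * ln T%:R ^+ 4 * ln ((#|S| * #|A| * T)%:R / delta)
      / ((1 - gamma) ^+ 4 * eps ^+ 2) <= T%:R ->
    (forall s a, 0 <= Q0 s a <= 1 / (1 - gamma)) ->
    1 - delta <=
      Prob P (fun omega : {ffun 'I_T * S * A -> S} =>
        \big[Num.max/0]_(x : S * A)
          `|Qlearn a0 r gamma eta Q0 (sample_of omega) T x.1 x.2
            - Qstar P r gamma x.1 x.2| <= eps).
Proof.
(* With [c1 <= 1/8] the step sizes are large enough for the second half of the run to contract by
   [expR (- ln T)]; see [LD_le]. *)
exists 8^-1; split=> [|c1 c2 c2_gt0 c21 c1_le]; first by rewrite invr_gt0.
(* [B] is kept opaque: unfolding [2048] in unary is slow. *)
have [B B_eq] : exists B : R, B = 2048 by exists 2048.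
have B_gt0 : 0 < B by rewrite B_eq; lra.
(* [c2 * c3 >= B] serves [noise_small], where [2048 = 512 * 2 * 2] comes from [l = 2 * l0] and the 2
   in [eb]; [c3 >= B] gives the lower bounds on [T] free of [c2]. *)
pose c3 : R := B / c2 + B.
have c3_ge : B <= c3 by rewrite lerDr divr_ge0 // ltW.
have c3_gt0 : 0 < c3 by apply: lt_le_trans c3_ge.
exists c3; split=> // S A a0 P r gamma delta eps eta T Q0 P_kernel r_bounds.
move=> /andP[delta_gt0 delta_lt1] /andP[eps_gt0 eps_le1].
move=> /andP[gamma_ge_half gamma_lt1] T_gt1 eta_bounds T_large Q0_bounds.
(* Without states the logarithm is degenerate, but the maximum is the default 0 and the event is
   certain. *)
have [S_empty|S_gt0] := posnP #|S|.
  have all_good (w : {ffun 'I_T * S * A -> S}) : \big[Num.max/0]_(x : S * A)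
      `|Qlearn a0 r gamma eta Q0 (sample_of w) T x.1 x.2
        - Qstar P r gamma x.1 x.2| <= eps.
    apply: (big_ind (fun y => y <= eps)) => [|y z ye ze|[s a] _]; first exact: ltW.
      by rewrite ge_max ye ze.
    by have := fintype0 s S_empty.
  have -> : Prob P (fun w : {ffun 'I_T * S * A -> S} => \big[Num.max/0]_(x : S * A)
      `|Qlearn a0 r gamma eta Q0 (sample_of w) T x.1 x.2
        - Qstar P r gamma x.1 x.2| <= eps) = 1.
    have [_ P_sum1] := P_kernel.
    rewrite -[RHS](sum_weight (fun k : 'I_T * S * A => P_sum1 k.1.2 k.2)).
    exact: eq_bigl.
  by rewrite lerBlDr lerDl ltW.
have A_gt0 : (0 < #|A|)%N by apply/card_gt0P; exists a0.
set L := ln T%:R in eta_bounds T_large.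
set l0 := ln _ in T_large.
set H := (1 - gamma)^-1.
have h_gt0 : 0 < 1 - gamma by rewrite subr_gt0.
have H_ge1 : 1 <= H by rewrite -[leLHS]invr1 lef_pV2 ?posrE // lerBlDl lerDr; lra.
have H_gt0 : 0 < H by rewrite invr_gt0.
have hH : (1 - gamma) * H = 1 by rewrite divff ?gt_eqF.
have T_gt0 : 0 < T%:R :> R by rewrite ltr0n ltnW.
have T_ge2 : 2 <= T%:R :> R by rewrite ler_nat.
pose SAT : R := (#|S| * #|A| * T)%:R.
have SAT_ge : T%:R <= SAT by rewrite ler_nat leq_pmull // muln_gt0 S_gt0.
have SAT_gt0 : 0 < SAT by apply: lt_le_trans SAT_ge.
have l0_ge : L <= l0.
  rewrite /L /l0 ler_ln ?posrE ?divr_gt0 // ler_pdivlMr //.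
  by apply: le_trans SAT_ge; rewrite ler_piMr ?ltW.
have {}T_large : c3 * L ^+ 4 * l0 * H ^+ 4 <= T%:R * eps ^+ 2.
  move: T_large; rewrite ler_pdivrMr ?mulr_gt0 ?exprn_gt0 // => T_large.
  have := ler_wpM2r (exprn_ge0 4 (ltW H_gt0)) T_large.
  have -> : T%:R * ((1 - gamma) ^+ 4 * eps ^+ 2) * H ^+ 4
      = T%:R * eps ^+ 2 * ((1 - gamma) * H) ^+ 4 by ring.
  by rewrite hH expr1n mulr1.
have L_ge_half : 2^-1 <= L.
  by apply: le_trans (ln2_ge_half R) _; rewrite ler_ln ?posrE.
have L_gt0 : 0 < L by apply: lt_le_trans L_ge_half.
have T_ge_pow : B * L ^+ 4 * l0 * H ^+ 4 <= T%:R * eps ^+ 2.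
  apply: le_trans T_large; rewrite -!mulrA ler_wpM2r //.
  rewrite !mulr_ge0 ?exprn_ge0 ?(ltW H_gt0) ?(ltW L_gt0) //.
  exact: le_trans (ltW L_gt0) l0_ge.
(* The sample size condition rules out [T < 4]: it would give [2048 / 32 <= 4]. *)
have L_ge1 : 1 <= L.
  have [T_lt4|T_ge4] := ltnP T 4; last first.
    apply: (@le_trans _ _ (ln (2 ^+ 2))).
      by rewrite expr2 lnM ?posrE //; have := ln2_ge_half R; lra.
    by rewrite /L ler_ln ?posrE ?exprn_gt0 // -natrX ler_nat.
  have pow_le : 2^-1 ^+ 4 <= L ^+ 4 by apply: lerXn2r; rewrite ?nnegrE ?(ltW L_gt0).
  have l0_half : 2^-1 <= l0 by apply: le_trans l0_ge.
  have lower : B * 2^-1 ^+ 4 * 2^-1 <= B * L ^+ 4 * l0.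
    apply: ler_pM => //; first by rewrite mulr_ge0 ?exprn_ge0 ?(ltW B_gt0).
    by rewrite ler_pM2l.
  have grow : B * L ^+ 4 * l0 <= B * L ^+ 4 * l0 * H ^+ 4.
    rewrite ler_peMr ?exprn_ege1 // !mulr_ge0 ?exprn_ge0 ?(ltW B_gt0) ?(ltW L_gt0) //.
    exact: le_trans l0_half.
  have upper : T%:R * eps ^+ 2 <= 4 * 1.
    apply: ler_pM; rewrite ?exprn_ge0 ?ler0n ?(ltW eps_gt0) //.
      by rewrite ler_nat ltnW.
    by rewrite exprn_ile1 ?(ltW eps_gt0).
  have := le_trans lower (le_trans grow (le_trans T_ge_pow upper)).
  rewrite B_eq; lra.
have T_ge : B * L * H ^+ 4 <= T%:R * eps ^+ 2.
  apply: le_trans T_ge_pow; apply: ler_wpM2r; first by rewrite exprn_ge0 // ltW.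
  rewrite -mulrA ler_wpM2l ?(ltW B_gt0) // -[leLHS]mul1r ler_pM ?exprn_ege1 //; exact: ltW.
(* This is the upper bound on the step size at [t = T / 2], with the summand 1 dropped. *)
pose eb := 2 * L ^+ 3 * H / (c2 * T%:R).
pose lo := 1 / (1 + c1 * (1 - gamma) * T%:R / L ^+ 3).
pose tau := (T %/ 2)%N.
have c1_gt0 : 0 < c1 by apply: lt_le_trans c21.
have eta_01 t : (t <= T)%N -> 0 <= eta t <= 1.
  move=> tT; have /andP[e_lo e_hi] := eta_bounds t tT; apply/andP; split.
    apply: le_trans e_lo; rewrite divr_ge0 // addr_ge0 // divr_ge0 ?exprn_ge0 ?(ltW L_gt0) //.
    by rewrite !mulr_ge0 // ?ltW.
  apply: le_trans e_hi _; rewrite ler_pdivrMr ?mul1r.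
    by rewrite lerDl divr_ge0 ?exprn_ge0 ?(ltW L_gt0) // !mulr_ge0 // ?ler0n ltW.
  rewrite ltr_wpDr // divr_ge0 ?exprn_ge0 ?(ltW L_gt0) // !mulr_ge0 // ?ler0n ltW //.
have eta_tail t : (tau < t <= T)%N -> lo <= eta t <= eb.
  move=> /andP[tau_t tT]; have /andP[e_lo e_hi] := eta_bounds t tT.
  rewrite e_lo /=; apply: le_trans e_hi _.
  have t_half : T%:R / 2 <= t%:R :> R.
    by rewrite ler_pdivrMr // -natrM ler_nat ltnW // -ltn_divLR.
  have eb_inv : eb^-1 = c2 * (1 - gamma) * (T%:R / 2) / L ^+ 3.
    by rewrite /eb /H; field; rewrite !gt_eqF.
  have eb_pos : 0 < eb by rewrite /eb divr_gt0 ?mulr_gt0 ?exprn_gt0.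
  rewrite div1r -[leRHS]invrK eb_inv lef_pV2 ?posrE.
  - rewrite -[leLHS]add0r lerD // ler_wpM2r ?invr_ge0 ?exprn_ge0 ?(ltW L_gt0) //.
    by rewrite ler_wpM2l // mulr_ge0 // ltW.
  - rewrite ltr_wpDr // divr_ge0 ?exprn_ge0 ?(ltW L_gt0) //.
    by rewrite mulr_ge0 // ?mulr_ge0 // ltW.
  - by rewrite -eb_inv invr_gt0.
have tail_length : T%:R / 2 <= (T - tau)%:R :> R.
  rewrite natrB ?leq_div //.
  have : (tau * 2)%:R <= T%:R :> R by rewrite ler_nat leq_divM.
  rewrite natrM; lra.
have burn_in : 3 * H * expR (- ((T - tau)%:R * (lo * ((1 - gamma) / 2)))) <= eps / 2.
  have H_le_pow : H <= H ^+ 4 by rewrite -[leLHS]expr1 ler_weXn2l.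
  have LH_ge : B * (L * H) <= T%:R * eps ^+ 2.
    apply: le_trans T_ge; rewrite -[leRHS]mulrA ler_pM2l // ler_pM2l //.
  have eps2_le : T%:R * eps ^+ 2 <= T%:R * eps.
    by rewrite ler_pM2l // expr2 ler_piMl // ltW.
  have eps_T : T%:R * eps <= T%:R by rewrite ler_piMr // ltW.
  have H_le : H <= L * H by rewrite ler_peMl // ltW.
  have h_T : 8 * L <= T%:R * (1 - gamma).
    have : 8 * (L * H) <= T%:R by have := H_gt0; move: LH_ge; rewrite B_eq; lra.
    move=> /(ler_wpM2r (ltW h_gt0)); apply: le_trans.
    by rewrite -!mulrA [H * _]mulrC hH mulr1.
  pose D := 1 + c1 * (1 - gamma) * T%:R / L ^+ 3.
  have D_ge1 : 1 <= D.
    rewrite lerDl divr_ge0 ?exprn_ge0 ?(ltW L_gt0) //.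
    by rewrite mulr_ge0 // mulr_ge0 // ltW.
  have D_gt0 : 0 < D by apply: lt_le_trans D_ge1.
  have LD_le : L * D <= T%:R * (1 - gamma) / 4.
    have -> : L * D = L + c1 * (T%:R * (1 - gamma)) / L ^+ 2.
      by rewrite /D; field; rewrite gt_eqF.
    have : c1 * (T%:R * (1 - gamma)) / L ^+ 2 <= 8^-1 * (T%:R * (1 - gamma)).
      rewrite ler_pdivrMr ?exprn_gt0 // -[leLHS]mulr1 ler_pM ?exprn_ege1 //.
        by rewrite mulr_ge0 ?mulr_ge0 // ltW.
      by rewrite ler_wpM2r // mulr_ge0 // ltW.
    lra.
  have decay : L <= (T - tau)%:R * (lo * ((1 - gamma) / 2)).
    apply: (@le_trans _ _ (T%:R / 2 * (lo * ((1 - gamma) / 2)))); last first.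
      rewrite ler_wpM2r // mulr_ge0 ?divr_ge0 ?(ltW h_gt0) //.
      by rewrite -/D ltW.
    have -> : T%:R / 2 * (lo * ((1 - gamma) / 2)) = T%:R * (1 - gamma) / 4 / D.
      by rewrite /lo -/D; field; rewrite gt_eqF.
    by rewrite ler_pdivlMr.
  apply: (@le_trans _ _ (3 * H * T%:R^-1)).
    rewrite ler_pM2l ?mulr_gt0 // -[T%:R]lnK ?posrE // -expRN ler_expR lerN2.
    by rewrite -/L.
  rewrite ler_pdivrMr //; move: LH_ge; rewrite B_eq; have := H_gt0; lra.
have noise_small : 512 * (2 * l0) * eb * H ^+ 3 <= eps ^+ 2.
  have -> : 512 * (2 * l0) * eb * H ^+ 3 = 2048 * (L ^+ 3 * l0 * H ^+ 4) / (c2 * T%:R).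
    by rewrite /eb; field; rewrite !gt_eqF.
  rewrite -B_eq ler_pdivrMr ?mulr_gt0 //.
  have l0_ge0 : 0 <= l0 by rewrite (le_trans _ l0_ge) // ltW.
  have := ler_wpM2l (ltW c2_gt0) T_large.
  have -> : eps ^+ 2 * (c2 * T%:R) = c2 * (T%:R * eps ^+ 2) by ring.
  apply: le_trans.
  have -> : c2 * (c3 * L ^+ 4 * l0 * H ^+ 4) = c2 * c3 * (L * (L ^+ 3 * l0 * H ^+ 4)).
    by ring.
  have X_ge0 : 0 <= L ^+ 3 * l0 * H ^+ 4.
    by rewrite !mulr_ge0 ?exprn_ge0 ?(ltW L_gt0) ?(ltW H_gt0).
  apply: ler_pM => //; first exact: ltW; last by rewrite ler_peMl.
  rewrite /c3 mulrDr mulrCA divff ?gt_eqF // mulr1 lerDl.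
  by rewrite mulr_ge0 // ltW.
have eb_gt0 : 0 < eb by rewrite /eb divr_gt0 ?mulr_gt0 ?exprn_gt0.
have Q0_H s a : 0 <= Q0 s a <= H by rewrite /H -div1r.
have := @Qlearn_error_probability R S A a0 P r gamma P_kernel r_bounds gamma_ge_half
  gamma_lt1 eta Q0 T tau eps eb lo (2 * l0) (leq_div _ _) eta_01 eta_tail eb_gt0 eps_gt0
  eps_le1 Q0_H noise_small burn_in.
apply: le_trans.
(* Doubling [l0] squares [delta / SAT], which absorbs the factor 2 from the signs because
   [SAT >= 2]. *)
have expN : expR (- (2 * l0)) = (delta / SAT) ^+ 2.
  by rewrite -mulrN expRM_natl expRN lnK ?posrE ?divr_gt0 // invf_div.
rewrite lerD2l lerN2 expN.
(* The [n.+1] times number at most [T] because [tau >= 1]. *)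
have count_le : (2 * ((T - tau).+1 * #|S| * #|A|))%:R <= 2 * SAT.
  rewrite -natrM ler_nat leq_mul2l /= -mulnA mulnC leq_mul2l; apply/orP; right.
  by rewrite ltn_subrL divn_gt0 // T_gt1 ltnW.
apply: le_trans (ler_wpM2r (sqr_ge0 _) count_le) _; clearbody SAT.
have -> : 2 * SAT * (delta / SAT) ^+ 2 = 2 * delta / SAT * delta.
  by field; rewrite gt_eqF.
rewrite ler_piMl ?(ltW delta_gt0) // ler_pdivrMr // mul1r.
by have := le_trans T_ge2 SAT_ge; lra.
Qed.
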